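(* Let $R$ be a ring and $G$ a group. (1) If the group ring $RG$ is UnitUC, then $R$ is UnitUC and $G$ is a $2$-group. (2) If $R$ is a UnitUC ring and $G$ is a locally finite $2$-group, then $RG$ is a UnitUC ring.
   Context: Rings are associative with $1\neq 0$; $U(R)$ is the group of units, $Id(R)$ the set of idempotents of $R$. A $2$-group is a group in which every element has order a power of $2$; a group is locally finite if every finitely generated subgroup is finite. A ring $R$ is clean if every $a\in R$ can be written as $a=e+u$ with $e\in Id(R)$, $u\in U(R)$. For $e,f\in Id(R)$ write $e\sim f$ if there is $u\in U(R)$ with $e=u^{-1}fu$. $R$ is unit uniquely clean (UnitUC) if it is clean and, whenever $e+u=f+v$ with $e,f\in Id(R)$ and $u,v\in U(R)$, one has $e\sim f$. *)

(* Defs.v *)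
From HB Require Import structures.
From mathcomp Require Import all_boot all_algebra.
From mathcomp Require Import finmap.
From mathcomp Require Import monalg.

Set Implicit Arguments.
Unset Strict Implicit.
Unset Printing Implicit Defensive.

Import GRing.Theory.

Local Open Scope fset_scope.
Local Open Scope ring_scope.

(* The group ring RG. Its additive group is {malg R[G]}, the finitely supported
   functions G -> R. The product that monalg puts on {malg R[K]} requires a
   monoid K in which x * y = 1 forces x = y = 1, so it is not available for a
   group; it is defined here on an alias of {malg R[G]}. *)
Definition group_ring (R : nzRingType) (G : groupType) : Type := {malg R[G]}.

HB.instance Definition _ (R : nzRingType) (G : groupType) :=
  GRing.Zmodule.on (group_ring R G).

Section GroupRing.
Context (R : nzRingType) (G : groupType).
Implicit Types (x y z : {malg R[G]}) (g h k : G) (a b : R).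

Definition gr_one : {malg R[G]} := << 1%R *g 1%g >>.

Definition gr_mul x y : {malg R[G]} :=
  \sum_(g <- msupp x) \sum_(h <- msupp y) << x@_g * y@_h *g (g * h)%g >>.

Lemma gr_mulw (d1 d2 : {fset G}) x y :
  msupp x `<=` d1 -> msupp y `<=` d2 ->
  gr_mul x y = \sum_(g <- d1) \sum_(h <- d2) << x@_g * y@_h *g (g * h)%g >>.
Proof.
move=> le1 le2; rewrite /gr_mul (big_fset_incl _ le1) /=.
  apply/eq_bigr=> g _; apply/big_fset_incl => // h _ /mcoeff_outdom ->.
  by rewrite mulr0 monalgU0.
move=> g _ /mcoeff_outdom xg.
by rewrite big1 // => h _; rewrite xg mul0r monalgU0.
Qed.

Lemma gr_mul0l : left_zero 0 gr_mul.
Proof. by move=> x; rewrite /gr_mul msupp0 big_seq_fset0. Qed.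

Lemma gr_mul0r : right_zero 0 gr_mul.
Proof.
by move=> x; rewrite /gr_mul big1 // => g _; rewrite msupp0 big_seq_fset0.
Qed.

Lemma gr_mulUl a g y :
  gr_mul << a *g g >> y = \sum_(h <- msupp y) << a * y@_h *g (g * h)%g >>.
Proof.
rewrite (gr_mulw msuppU_le (fsubset_refl _)) big_seq_fset1.
by apply/eq_bigr => h _; rewrite mcoeffUU.
Qed.

Lemma gr_mulUr x b h :
  gr_mul x << b *g h >> = \sum_(g <- msupp x) << x@_g * b *g (g * h)%g >>.
Proof.
rewrite (gr_mulw (fsubset_refl _) msuppU_le).
by apply/eq_bigr => g _; rewrite big_seq_fset1 mcoeffUU.
Qed.

Lemma gr_mulUU a b g h :
  gr_mul << a *g g >> << b *g h >> = << a * b *g (g * h)%g >>.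
Proof. by rewrite (gr_mulw msuppU_le msuppU_le) !big_seq_fset1 !mcoeffUU. Qed.

Lemma gr_mulEl x y :
  gr_mul x y = \sum_(g <- msupp x) gr_mul << x@_g *g g >> y.
Proof. by apply/eq_bigr=> g _; rewrite gr_mulUl. Qed.

Lemma gr_mulEr x y :
  gr_mul x y = \sum_(h <- msupp y) gr_mul x << y@_h *g h >>.
Proof.
rewrite {1}/gr_mul exchange_big /=.
by apply/eq_bigr=> h _; rewrite gr_mulUr.
Qed.

Lemma gr_mul1l : left_id gr_one gr_mul.
Proof.
move=> x; rewrite gr_mulUl [RHS]monalgE.
by apply/eq_bigr=> g _; rewrite mul1r mul1g.
Qed.

Lemma gr_mul1r : right_id gr_one gr_mul.
Proof.
move=> x; rewrite gr_mulUr [RHS]monalgE.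
by apply/eq_bigr=> g _; rewrite mulr1 mulg1.
Qed.

Lemma gr_mulDl : left_distributive gr_mul +%R.
Proof.
move=> x y z.
rewrite [in RHS](gr_mulw (fsubsetUl _ (msupp y)) (fsubset_refl _)).
rewrite [in RHS](gr_mulw (fsubsetUr (msupp x) _) (fsubset_refl _)).
rewrite (gr_mulw (msuppD_le _ _) (fsubset_refl _)).
rewrite -big_split /=; apply/eq_bigr=> g _.
rewrite -big_split /=; apply/eq_bigr=> h _.
by rewrite mcoeffD mulrDl monalgUD.
Qed.

Lemma gr_mulDr : right_distributive gr_mul +%R.
Proof.
move=> x y z.
rewrite [in RHS](gr_mulw (fsubset_refl _) (fsubsetUl _ (msupp z))).
rewrite [in RHS](gr_mulw (fsubset_refl _) (fsubsetUr (msupp y) _)).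
rewrite (gr_mulw (fsubset_refl _) (msuppD_le _ _)).
rewrite -big_split /=; apply/eq_bigr=> g _.
rewrite -big_split /=; apply/eq_bigr=> h _.
by rewrite mcoeffD mulrDr monalgUD.
Qed.

Lemma gr_mulA : associative gr_mul.
Proof.
move=> x y z.
rewrite [RHS](big_morph (gr_mul^~ _) (fun _ _ => gr_mulDl _ _ _) (gr_mul0l _)).
rewrite gr_mulEl; apply/eq_bigr=> g _.
rewrite [LHS](big_morph (gr_mul _) (fun _ _ => gr_mulDr _ _ _) (gr_mul0r _)).
rewrite [RHS](big_morph (gr_mul^~ _) (fun _ _ => gr_mulDl _ _ _) (gr_mul0l _)).
apply/eq_bigr=> h _.
rewrite [LHS](big_morph (gr_mul _) (fun _ _ => gr_mulDr _ _ _) (gr_mul0r _)).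
by rewrite gr_mulEr; apply/eq_bigr=> k _; rewrite !gr_mulUU mulrA mulgA.
Qed.

Lemma gr_one_neq0 : gr_one != 0.
Proof. by rewrite monalgU_eq0 oner_eq0. Qed.

HB.instance Definition _ := GRing.Zmodule_isNzRing.Build (group_ring R G)
  gr_mulA gr_mul1l gr_mul1r gr_mulDl gr_mulDr gr_one_neq0.

End GroupRing.

Section Rings.
Context (R : nzRingType).
Implicit Types (a e f u v : R).

(* A bare nzRingType carries no GRing.unit predicate and no inverse operation,
   so units are the two-sided invertible elements. *)
Definition inverse_of u v : Prop := u * v = 1 /\ v * u = 1.

Definition is_unit u : Prop := exists v, inverse_of u v.

Definition is_idempotent e : Prop := e * e = e.

Definition conjugate e f : Prop := exists u v, inverse_of u v /\ e = v * f * u.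

End Rings.

Definition clean (R : nzRingType) : Prop :=
  forall a : R, exists e u : R, [/\ is_idempotent e, is_unit u & a = e + u].

Definition UnitUC (R : nzRingType) : Prop :=
  clean R /\
  forall e f u v : R, is_idempotent e -> is_idempotent f ->
    is_unit u -> is_unit v -> e + u = f + v -> conjugate e f.

Section Groups.
Context (G : groupType).
Implicit Types (g h : G).

Definition has_order g (m : nat) : Prop :=
  [/\ (0 < m)%N, (g ^+ m)%g = 1%g
    & forall k : nat, (0 < k)%N -> (g ^+ k)%g = 1%g -> (m <= k)%N].

Inductive in_generated (s : seq G) : G -> Prop :=
| in_generated_base g : g \in s -> in_generated s g
| in_generated_one : in_generated s 1%g
| in_generated_mul g h :
    in_generated s g -> in_generated s h -> in_generated s (g * h)%g
| in_generated_inv g : in_generated s g -> in_generated s g^-1%g.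

End Groups.

Definition two_group (G : groupType) : Prop :=
  forall g : G, exists n : nat, has_order g (2 ^ n).

Definition locally_finite (G : groupType) : Prop :=
  forall s : seq G, exists t : seq G, forall g : G, in_generated s g -> g \in t.

(* Main.v *)
Require Import Defs.
From Stdlib Require Import Classical Setoid Morphisms Ncring Ncring_tac.
From HB Require Import structures.
From mathcomp Require Import all_boot all_algebra all_fingroup all_solvable.
From mathcomp Require Import finmap monalg zify.

(** Both directions go through the fact that [R] is UnitUC if and only if every
    element is the sum of an idempotent and an element of the Jacobson radical
    [J(R)]. The nontrivial implication holds because in a UnitUC ring a unit [u]
    and a nonzero idempotent [e] never have [u - e] a unit; this excludes 2x2
    matrix corners, so that elements of square zero lie in [J(R)], idempotents
    are central modulo [J(R)], and all units lie in [1 + J(R)].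

    If [RG] has this property, so has its quotient [R], and [1 - g] lies in
    [J(RG)] for [g] in [G]. Hence [1 + g + ... + g^(q - 1)] is a unit for odd
    [q], which is impossible if [g] has odd order [q > 1], and, for [q = 3], if
    [g] has infinite order.

    Conversely, let [G] be a finite 2-group. Nakayama's lemma puts [J(R)] into
    [J(RG)], and then 2 and [1 - g] lie in [J(RG)]. So every element of [RG]
    with augmentation in [1 + J(R)] is a unit; by local finiteness this persists
    for the groups of the theorem. *)

Set Implicit Arguments.
Unset Strict Implicit.
Unset Printing Implicit Defensive.

Import GRing.Theory.

Local Open Scope ring_scope.

(** Makes [non_commutative_ring] available in every [nzRingType]. *)
#[local] Instance nzRing_Ring_ops (R : nzRingType) :
  @Ring_ops R 0 1 +%R *%R (fun x y => x - y) -%R eq := {}.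

#[local] Instance nzRing_Ring (R : nzRingType) : Ring (Ro := nzRing_Ring_ops R).
Proof.
split; try exact _.
- exact (@add0r R).
- exact (@addrC R).
- exact (@addrA R).
- exact (@mul1r R).
- exact (@mulr1 R).
- exact (@mulrA R).
- exact (@mulrDl R).
- exact (fun x y z => @mulrDr R z x y).
- by [].
- exact (@subrr R).
Qed.

(** * Units and idempotents *)

Section Units.
Context {R : nzRingType}.
Implicit Types a b c e u v w : R.

Lemma is_unit1 : is_unit (1 : R).
Proof. by exists 1; rewrite /inverse_of mulr1. Qed.

Lemma is_unitM u v : is_unit u -> is_unit v -> is_unit (u * v).
Proof.
move=> [u' [uu' u'u]] [v' [vv' v'v]]; exists (v' * u'); split.
  by rewrite mulrA -(mulrA u) vv' mulr1.
by rewrite mulrA -(mulrA v') u'u mulr1.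
Qed.

Lemma is_unitN u : is_unit u -> is_unit (- u).
Proof. by case=> v [uv vu]; exists (- v); split; rewrite mulrNN. Qed.

Lemma is_unit_lr u v w : v * u = 1 -> u * w = 1 -> is_unit u.
Proof.
move=> vu uw; exists v; split=> //.
have -> : v = w by rewrite -[v]mulr1 -uw mulrA vu mul1r.
by [].
Qed.

Lemma is_unit_factor a b c :
  is_unit (a * b) -> is_unit (c * a) -> is_unit a.
Proof.
move=> [v [abv _]] [w [_ wca]].
by apply: (@is_unit_lr _ (w * c) (b * v)); rewrite ?mulrA // -mulrA.
Qed.

(** The geometric series suggests the inverse [1 + b (1 - a b)^-1 a]. *)
Lemma is_unit_swap a b : is_unit (1 - a * b) -> is_unit (1 - b * a).
Proof.
case=> w [h1 h2]; exists (1 + b * w * a); split.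
  have -> : (1 - b * a) * (1 + b * w * a)
    = 1 - b * a + b * ((1 - a * b) * w) * a by non_commutative_ring.
  by rewrite h1 mulr1 subrK.
have -> : (1 + b * w * a) * (1 - b * a)
  = 1 - b * a + b * (w * (1 - a * b)) * a by non_commutative_ring.
by rewrite h2 mulr1 subrK.
Qed.

Lemma idempotent_unit e : is_idempotent e -> is_unit e -> e = 1.
Proof. by move=> ee [v [ev _]]; rewrite -[e]mulr1 -ev mulrA ee. Qed.

Lemma idempotentC e : is_idempotent e -> is_idempotent (1 - e).
Proof.
rewrite /is_idempotent => ee.
have -> : (1 - e) * (1 - e) = 1 - e + (e * e - e) by non_commutative_ring.
by rewrite ee subrr addr0.
Qed.

End Units.

(** * The Jacobson radical *)

(** Only left multiples are tested; [is_unit_swap] makes the condition two-sided. *)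
Definition jacobson {R : nzRingType} (x : R) : Prop :=
  forall a, is_unit (1 - a * x).

(** With the [Proper] instances below, rewriting along [eqJ] computes in R/J(R) without forming the
    quotient. *)
Definition eqJ {R : nzRingType} (x y : R) : Prop := jacobson (x - y).

Definition jclean (R : nzRingType) : Prop :=
  forall a : R, exists2 e, is_idempotent e & jacobson (a - e).

Section Jacobson.
Context {R : nzRingType}.
Implicit Types a b u v w x y : R.

Lemma jacobson0 : jacobson (0 : R).
Proof. by move=> a; rewrite mulr0 subr0; exact: is_unit1. Qed.

Lemma jacobsonMl a x : jacobson x -> jacobson (a * x).
Proof. by move=> Jx b; rewrite mulrA. Qed.

Lemma jacobsonMr x b : jacobson x -> jacobson (x * b).
Proof. by move=> Jx a; rewrite mulrA; apply: is_unit_swap; rewrite mulrA. Qed.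

Lemma jacobsonN x : jacobson x -> jacobson (- x).
Proof. by rewrite -mulN1r; exact: jacobsonMl. Qed.

Lemma jacobson_unitB u x : is_unit u -> jacobson x -> is_unit (u - x).
Proof.
move=> Uu Jx; have [v [uv vu]] := Uu.
have -> : u - x = u * (1 - v * x) by rewrite mulrBr mulr1 mulrA uv mul1r.
exact: is_unitM.
Qed.

Lemma jacobsonD x y : jacobson x -> jacobson y -> jacobson (x + y).
Proof.
move=> Jx Jy a; rewrite mulrDr opprD addrA.
by apply: jacobson_unitB => //; exact: jacobsonMl.
Qed.

Lemma jacobsonB x y : jacobson x -> jacobson y -> jacobson (x - y).
Proof. by move=> Jx Jy; apply: jacobsonD => //; exact: jacobsonN. Qed.

Lemma jacobson_sum (I : Type) (r : seq I) (F : I -> R) :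
  (forall i, jacobson (F i)) -> jacobson (\sum_(i <- r) F i).
Proof.
move=> JF; elim/big_ind: _ => //; [exact: jacobson0 | exact: jacobsonD].
Qed.

(** A left inverse [w] of [1 - a x] equals [1 + w a x], so it has a left inverse in turn; hence [w]
    and [1 - a x] are units. *)
Lemma jacobson_left_inverse x :
  (forall a, exists w, w * (1 - a * x) = 1) -> jacobson x.
Proof.
move=> inv a; have [w wP] := inv a; have [w' w'P] := inv (- (w * a)).
have wE : w = 1 - - (w * a) * x.
  by rewrite -wP; non_commutative_ring.
rewrite -wE in w'P.
have w'E : w' = 1 - a * x by rewrite -[LHS]mulr1 -{1}wP mulrA w'P mul1r.
by exists w; rewrite -w'E in wP *.
Qed.

#[export] Instance eqJ_equiv : Equivalence (@eqJ R).
Proof.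
split=> [x | x y | x y z]; rewrite /eqJ.
- by rewrite subrr; exact: jacobson0.
- by rewrite -opprB => /jacobsonN; rewrite opprK.
- by move=> /jacobsonD J1 /J1; rewrite addrA subrK.
Qed.

#[export] Instance eqJ_add : Proper (eqJ ==> eqJ ==> eqJ) (@GRing.add R).
Proof.
by move=> x x' Jx y y' Jy; rewrite /eqJ opprD addrACA; exact: jacobsonD.
Qed.

#[export] Instance eqJ_opp : Proper (eqJ ==> eqJ) (@GRing.opp R).
Proof. by move=> x x' Jx; rewrite /eqJ -opprD; exact: jacobsonN. Qed.

#[export] Instance eqJ_mul : Proper (eqJ ==> eqJ ==> eqJ) (@GRing.mul R).
Proof.
move=> x x' Jx y y' Jy; rewrite /eqJ.
have -> : x * y - x' * y' = x * (y - y') + (x - x') * y'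
  by non_commutative_ring.
by apply: jacobsonD; [exact: jacobsonMl | exact: jacobsonMr].
Qed.

Lemma eqJ0 x : jacobson x <-> eqJ x 0.
Proof. by rewrite /eqJ subr0. Qed.

Lemma eqJ_is_unit u v : is_unit u -> eqJ u v -> is_unit v.
Proof. by move=> Uu /(jacobson_unitB Uu); rewrite subKr. Qed.

Lemma eqJ_inverse a b : eqJ (a * b) 1 -> eqJ (b * a) 1 -> is_unit a.
Proof.
move=> ab ba; apply: (@is_unit_factor _ _ b b).
  by apply: (eqJ_is_unit is_unit1); symmetry.
by apply: (eqJ_is_unit is_unit1); symmetry.
Qed.

End Jacobson.

(** * UnitUC rings *)

Section UnitUCJclean.
Context {R : nzRingType}.
Implicit Types a b e f r u v w x y : R.

(** Clean rings are exchange rings: if [a x = e + u], the idempotent [u^-1 (1 - e) u] lies in the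
    left ideal of [x]. It vanishes only if [e = 1], and then [1 - a x = - u] is a unit. *)
Lemma clean_exchange x : clean R -> ~ jacobson x ->
  exists r, [/\ is_idempotent (r * x), r * x <> 0 & r * x * r = r].
Proof.
move=> clR /not_all_ex_not[a nU].
have [e [u [ee Uu axE]]] := clR (a * x).
have [w [uw wu]] := Uu.
set f := w * (1 - e) * u; pose s := 1 - w * (a * x - 1).
have ff : f * f = f.
  have -> : f * f = w * ((1 - e) * (u * w) * (1 - e)) * u.
    by rewrite /f; non_commutative_ring.
  by rewrite uw mulr1 (idempotentC ee).
have sf : s * (a * x) = f.
  rewrite /s /f axE.
  have -> : (1 - w * (e + u - 1)) * (e + u) = e + u - w * (e * e) - w * e * u
     - w * u * e - w * u * u + w * e + w * u by non_commutative_ring.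
  rewrite ee wu.
  have -> : w * (1 - e) * u = w * u - w * e * u by non_commutative_ring.
  by rewrite wu; non_commutative_ring.
have ufw : u * f * w = 1 - e by rewrite /f !mulrA uw mul1r -mulrA uw mulr1.
clearbody f s; exists (f * s * a).
have fE : f * s * a * x = f by rewrite -!mulrA sf ff.
rewrite fE; split=> //; last by rewrite !mulrA ff.
move=> f0; apply: nU; rewrite axE.
have -> : e = 1 by rewrite -(subKr 1 e) -ufw f0 mulr0 mul0r subr0.
by rewrite opprD addrA subrr add0r; exact: is_unitN.
Qed.

Hypothesis UUC : UnitUC R.

(** Compare [e + (u - e) = 0 + u]; only 0 is conjugate to 0. *)
Lemma UnitUC_unit_idempotent u e :
  is_idempotent e -> is_unit u -> is_unit (u - e) -> e = 0.
Proof.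
move=> ee Uu Uue; case: UUC => _ uniq.
have id0 : is_idempotent (0 : R) by rewrite /is_idempotent mulr0.
have uE : e + (u - e) = 0 + u by rewrite add0r addrC subrK.
by have [v [w [_ ->]]] := uniq _ _ _ _ ee id0 Uue Uu uE; rewrite mulr0 mul0r.
Qed.

(* Otherwise [e = r x] and [x r (1 - e)] are orthogonal isomorphic idempotents,
   and [[1 1][1 0]] - [[1 0][0 0]] = [[0 1][1 0]] is a difference of a unit and
   a nonzero idempotent which is a unit. *)
Lemma UnitUC_square_zero x : x * x = 0 -> jacobson x.
Proof.
move=> xx; apply: NNPP => /(clean_exchange UUC.1)[r [ee e0 er]].
apply: e0; set e := r * x in ee er *.
have eE : r * x = e by []; clearbody e.
have ex : e * x = 0 by rewrite -eE -mulrA xx mulr0.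
(* [e], [q], [p], [f] multiply like the matrix units e11, e12, e21, e22. *)
pose p := x * e; pose q := r * (1 - e); pose f := x * r * (1 - e).
have ep : e * p = 0 by rewrite /p mulrA ex mul0r.
have eq : e * q = q by rewrite /q mulrA er.
have pe : p * e = p by rewrite /p -mulrA ee.
have qe : q * e = 0 by rewrite /q -mulrA mulrBl mul1r ee subrr mulr0.
have ef : e * f = 0 by rewrite /f !mulrA ex !mul0r.
have fe : f * e = 0 by rewrite /f -mulrA mulrBl mul1r ee subrr mulr0.
have pq : p * q = f by rewrite /p /q /f -!mulrA (mulrA e r) er.
have qp : q * p = e.
  have -> : q * p = r * x * e - r * (e * x) * e
    by rewrite /p /q; non_commutative_ring.
  by rewrite ex mulr0 mul0r subr0 eE ee.
clearbody p q f.
have pp : p * p = 0 by rewrite -{1}pe -mulrA ep mulr0.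
have qq : q * q = 0 by rewrite -{2}eq mulrA qe mul0r.
have fp : f * p = p by rewrite -pq -mulrA qp pe.
have pf : p * f = 0 by rewrite -pq mulrA pp mul0r.
have fq : f * q = 0 by rewrite -pq -mulrA qq mulr0.
have qf : q * f = q by rewrite -pq mulrA qp eq.
have ff : f * f = f by rewrite -{1}pq -mulrA qf pq.
(* The swap on the corner, extended by the identity on its complement. *)
pose w := p + q + (1 - e - f).
have ww : w * w = 1.
  have -> : w * w = p * p + p * q + q * p + q * q + (p + q) *+ 2 - p * e
    - p * f - q * e - q * f - e * p - e * q - f * p - f * q
    + 1 - e *+ 2 - f *+ 2 + e * e + e * f + f * e + f * f.
    by rewrite /w !mulr2n; non_commutative_ring.
  rewrite pp pq qp qq pe pf qe qf ep eq fp fq ee ef fe ff !mulr2n.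
  non_commutative_ring.
have Uw : is_unit w by exists w.
have ew : e * w = q.
  have -> : e * w = e * p + e * q + (e - e * e - e * f)
    by rewrite /w; non_commutative_ring.
  by rewrite ep eq ee ef add0r subrr subr0 addr0.
apply: (@UnitUC_unit_idempotent (e + w)) => //; last first.
  by rewrite addrAC subrr add0r.
have -> : e + w = (1 + q) * w.
  by rewrite mulrDl mul1r -ew -mulrA ww mulr1 addrC.
apply: is_unitM => //; exists (1 - q); split.
  have -> : (1 + q) * (1 - q) = 1 - q * q by non_commutative_ring.
  by rewrite qq subr0.
have -> : (1 - q) * (1 + q) = 1 - q * q by non_commutative_ring.
by rewrite qq subr0.
Qed.
(** The commutator is the difference of [e a (1 - e)] and [(1 - e) a e], both of square zero. *)
Lemma UnitUC_idempotent_central e a : is_idempotent e -> eqJ (e * a) (a * e).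
Proof.
move=> ee.
have e'e : (1 - e) * e = 0 by rewrite mulrBl mul1r ee subrr.
have ee' : e * (1 - e) = 0 by rewrite mulrBr mulr1 ee subrr.
rewrite /eqJ.
have -> : e * a - a * e = e * a * (1 - e) - (1 - e) * a * e
  by non_commutative_ring.
apply: jacobsonB; apply: UnitUC_square_zero.
  have -> : e * a * (1 - e) * (e * a * (1 - e))
    = e * a * ((1 - e) * e) * a * (1 - e) by non_commutative_ring.
  by rewrite e'e mulr0 !mul0r.
have -> : (1 - e) * a * e * ((1 - e) * a * e)
  = (1 - e) * a * (e * (1 - e)) * a * e by non_commutative_ring.
by rewrite ee' mulr0 !mul0r.
Qed.

(* Otherwise there is an idempotent [e = r (1 - u) <> 0], central modulo the
   Jacobson radical, and both [e u + (1 - e)] and [e u + (1 - e) - e] are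
   units. *)
Lemma UnitUC_unit_jacobson u : is_unit u -> jacobson (1 - u).
Proof.
case=> v [uv vu]; apply: NNPP => /(clean_exchange UUC.1)[r].
set x := 1 - u => -[]; set e := r * x => ee e0 er.
have eE : e = r * x by []; clearbody e.
have uE : u = 1 - x by rewrite /x subKr.
clearbody x; apply: e0.
(* The idempotents [r x] and [x r] are both central modulo the radical, so each is congruent to
   their product. *)
have xrE : eqJ (x * r) e.
  have ff : is_idempotent (x * r).
    by rewrite /is_idempotent mulrA -(mulrA x) -eE -mulrA er.
  transitivity (e * (x * r)).
    have {1}-> : x * r = x * e * r by rewrite -mulrA er.
    by rewrite -(UnitUC_idempotent_central x ee) -mulrA; reflexivity.
  have eE2 : r * ((x * r) * x) = e by rewrite -(mulrA x r x) (mulrA r x) -eE ee.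
  rewrite -[in X in eqJ _ X]eE2 (UnitUC_idempotent_central x ff) mulrA -eE.
  by reflexivity.
have xe := UnitUC_idempotent_central x ee.
have re := UnitUC_idempotent_central r ee.
have ue := UnitUC_idempotent_central u ee.
have ve := UnitUC_idempotent_central v ee.
have e'e' : 1 - e - e + e * e = 1 - e by rewrite ee subrK.
apply: (@UnitUC_unit_idempotent (e * u + (1 - e))) => //.
  apply: (@eqJ_inverse _ _ (e * v + (1 - e))).
    have -> : (e * u + (1 - e)) * (e * v + (1 - e))
      = e * (u * e) * v + (e * u - e * (u * e)) + (e * v - e * e * v)
        + (1 - e - e + e * e) by non_commutative_ring.
    rewrite e'e' -ue !mulrA ee -(mulrA e u v) uv !subrr !addr0 mulr1 subrKC.
    by reflexivity.
  have -> : (e * v + (1 - e)) * (e * u + (1 - e))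
    = e * (v * e) * u + (e * v - e * (v * e)) + (e * u - e * e * u)
      + (1 - e - e + e * e) by non_commutative_ring.
  rewrite e'e' -ve !mulrA ee -(mulrA e v u) vu !subrr !addr0 mulr1 subrKC.
  by reflexivity.
have -> : e * u + (1 - e) - e = 1 - e - e * x.
  by rewrite uE; non_commutative_ring.
(* On the [e]-component, [u - 1 = - x] has inverse [- r] modulo the radical. *)
apply: (@eqJ_inverse _ _ (1 - e - r)).
  have -> : (1 - e - e * x) * (1 - e - r)
    = (1 - e - e + e * e) - (r - e * r) - (e * x - e * (x * e)) + e * (x * r)
    by non_commutative_ring.
  rewrite e'e' -xe xrE !mulrA ee er !subrr !subr0 subrK; reflexivity.
have -> : (1 - e - r) * (1 - e - e * x)
  = (1 - e - e + e * e) - (e * x - e * e * x) - (r - r * e) + (r * e) * x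
  by non_commutative_ring.
by rewrite e'e' -re er -eE ee !subrr !subr0 subrK; reflexivity.
Qed.

(** If [a = e + u], then [a - (1 - e) = 2 e - (1 - u)]. Here 2, written [1 - - 1], lies in the
    radical because -1 is a unit. *)
Lemma UnitUC_jclean : jclean R.
Proof.
move=> a; have [e [u [ee Uu ->]]] := UUC.1 a.
have J2 : jacobson (1 - - 1 : R).
  by apply: UnitUC_unit_jacobson; apply: is_unitN; exact: is_unit1.
exists (1 - e); first exact: idempotentC.
have -> : e + u - (1 - e) = (1 - - 1) * e - (1 - u) by non_commutative_ring.
by apply: jacobsonB; [exact: jacobsonMr | exact: UnitUC_unit_jacobson].
Qed.

End UnitUCJclean.

(** * From radical decompositions back to UnitUC *)

Section Jclean.
Context {R : nzRingType}.
Hypothesis jcR : jclean R.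
Implicit Types e f u v : R.

(** The idempotent part of [u] is congruent to [u], hence a unit, hence 1. *)
Lemma jclean_unit u : is_unit u -> jacobson (1 - u).
Proof.
move=> Uu; have [e ee Jue] := jcR u.
have Ue := jacobson_unitB Uu Jue; rewrite subKr in Ue.
rewrite -opprB -(idempotent_unit ee Ue); exact: jacobsonN.
Qed.

(** Cleanness comes from the involution [2 e - 1], still a unit after adding a radical element.
    Units are congruent to 1, so the idempotents of two decompositions are congruent. *)
Lemma jclean_UnitUC : UnitUC R.
Proof.
split=> [a | e f u v ee ff Uu Uv eq].
  have [e ee Jae] := jcR a; exists (1 - e), (a - (1 - e)).
  split; [exact: idempotentC | | by rewrite subrKC].
  have -> : a - (1 - e) = (e - (1 - e)) - - (a - e) by non_commutative_ring.
  apply: jacobson_unitB; last exact: jacobsonN.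
  have sq : (e - (1 - e)) * (e - (1 - e)) = 1.
    have -> : (e - (1 - e)) * (e - (1 - e))
      = e * e + e * e + e * e + e * e - e - e - e - e + 1
      by non_commutative_ring.
    by rewrite ee; non_commutative_ring.
  by exists (e - (1 - e)).
have Jef : jacobson (e - f).
  have -> : e - f = (1 - u) - (1 - v).
    have -> : e = f + v - u by rewrite -eq addrK.
    non_commutative_ring.
  by apply: jacobsonB; exact: jclean_unit.
(* [w] is 1 modulo the radical and [e w = e f = w f]. *)
pose w := e * f + (1 - e) * (1 - f).
have [z [wz zw]] : is_unit w.
  apply: (eqJ_is_unit is_unit1); rewrite /eqJ.
  have -> : 1 - w = e * (e - f) - (1 - e) * (e - f) + (e - e * e + (e - e * e)).
    by rewrite /w; non_commutative_ring.
  rewrite ee subrr addr0 addr0.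
  by apply: jacobsonB; exact: jacobsonMl.
exists z, w; split=> //.
have ew : e * w = w * f.
  have -> : e * w = w * f + (e * e * f + e * e * f - e * f - e * f)
     + (e * f - e * (f * f) - e * (f * f) + e * f)
     + (e - e * e) + (f * f - f).
    by rewrite /w; non_commutative_ring.
  by rewrite ee ff; non_commutative_ring.
by rewrite -ew -mulrA wz mulr1.
Qed.

End Jclean.

(** * Group rings *)

Definition gr_mono {R : nzRingType} {G : groupType} (a : R) (g : G) :
  group_ring R G := << a *g g >>.

Section Monomials.
Context {R : nzRingType} {G : groupType}.
Implicit Types (x y : group_ring R G) (a b : R) (g h k : G).

Lemma gr_monoM a b g h : gr_mono a g * gr_mono b h = gr_mono (a * b) (g * h)%g.
Proof. exact: gr_mulUU. Qed.

Lemma gr_mono1M g h :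
  gr_mono (1 : R) (g * h)%g = gr_mono 1 g * gr_mono 1 h.
Proof. by rewrite gr_monoM mulr1. Qed.

Lemma gr_mono11 : gr_mono 1 1%g = 1 :> group_ring R G.
Proof. by []. Qed.

Lemma gr_mono1X g n : gr_mono (1 : R) (g ^+ n)%g = gr_mono 1 g ^+ n.
Proof.
by elim: n => [|n IHn]; rewrite ?expg0 ?expr0 // expgS exprS gr_mono1M IHn.
Qed.

Lemma gr_mono1_inj g h : gr_mono (1 : R) g = gr_mono 1 h -> g = h.
Proof.
move/(congr1 (mcoeff h)); rewrite /gr_mono !mcoeffU eqxx.
by case: eqP => // _ /eqP; rewrite eq_sym oner_eq0.
Qed.

Lemma gr_monoE x : x = \sum_(g <- msupp x) gr_mono x@_g g.
Proof. exact: (monalgE x). Qed.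

Lemma mcoeff_monoMl a g y k : (gr_mono a g * y)@_k = a * y@_(g^-1 * k)%g.
Proof.
rewrite {1}[y]gr_monoE [in RHS](monalgE y) mulr_sumr !raddf_sum mulr_sumr /=.
apply: eq_bigr => h _; rewrite gr_monoM /gr_mono !mcoeffU mulrnAr.
by rewrite -(inj_eq (mulgI g) h) mulKVg.
Qed.

Lemma mcoeff_monoMr x b h k : (x * gr_mono b h)@_k = x@_(k * h^-1)%g * b.
Proof.
rewrite {1}[x]gr_monoE [in RHS](monalgE x) mulr_suml !raddf_sum mulr_suml /=.
apply: eq_bigr => g _; rewrite gr_monoM /gr_mono !mcoeffU mulrnAl.
by rewrite -(inj_eq (mulIg h) g) mulgVK.
Qed.

Definition gr_const a : group_ring R G := gr_mono a 1%g.

Fact gr_const_additive : additive gr_const.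
Proof. exact: monalgUB. Qed.

Fact gr_const_multiplicative : multiplicative gr_const.
Proof. by split=> // a b; rewrite /gr_const gr_monoM mulg1. Qed.

HB.instance Definition _ := GRing.isAdditive.Build R (group_ring R G) gr_const
  gr_const_additive.
HB.instance Definition _ := GRing.isMultiplicative.Build R (group_ring R G)
  gr_const gr_const_multiplicative.

Lemma gr_mono_const a g : gr_mono a g = gr_const a * gr_mono 1 g.
Proof. by rewrite gr_monoM mulr1 mul1g. Qed.

Lemma gr_const_comm a g : gr_const a * gr_mono 1 g = gr_mono 1 g * gr_const a.
Proof. by rewrite !gr_monoM mulr1 mul1r mulg1 mul1g. Qed.

(** The multiplicative part of the universal property of the group ring. *)
Lemma mmapM (S : nzRingType) (f : {rmorphism R -> S}) (h : G -> S) x y :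
    {morph h : g k / (g * k)%g >-> g * k} ->
    (forall a g, f a * h g = h g * f a) ->
  mmap f h (x * y) = mmap f h x * mmap f h y.
Proof.
move=> hM fh; rewrite [x * y]/(gr_mul x y) /gr_mul raddf_sum !mmapE mulr_suml.
apply: eq_bigr => g _; rewrite raddf_sum mulr_sumr; apply: eq_bigr => k _ /=.
rewrite mmapU hM [X in X * _](rmorphM f) !mulrA; congr (_ * _).
by rewrite -!mulrA fh.
Qed.

Definition gr_aug : group_ring R G -> R := mmap idfun (fun=> 1).

HB.instance Definition _ := GRing.Additive.copy gr_aug (mmap idfun (fun=> 1)).

Lemma gr_aug_mono a g : gr_aug (gr_mono a g) = a.
Proof. by rewrite /gr_aug mmapU mulr1. Qed.

Fact gr_aug_multiplicative : multiplicative gr_aug.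
Proof.
split=> [x y|]; last exact: gr_aug_mono.
by apply: mmapM => [g h | a g]; rewrite ?mulr1 ?mul1r.
Qed.

HB.instance Definition _ := GRing.isMultiplicative.Build (group_ring R G) R
  gr_aug gr_aug_multiplicative.

End Monomials.

Lemma rmorph_is_unit (R S : nzRingType) (f : {rmorphism R -> S}) (u : R) :
  is_unit u -> is_unit (f u).
Proof.
by case=> v [uv vu]; exists (f v); split; rewrite -rmorphM ?uv ?vu rmorph1.
Qed.

(** * Radicals of group rings of finite groups *)

Section FiniteGroup.
Context {R : nzRingType} {gT : finGroupType}.
Implicit Types (x y t : group_ring R gT) (g h : gT).

Lemma gr_mono_enum x : x = \sum_(g <- enum gT) gr_mono x@_g g.
Proof.
rewrite big_enum /=; apply/malgP => k; rewrite raddf_sum (bigD1 k) //= mcoeffUU.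
rewrite big1 ?addr0 // => g gk.
by rewrite mcoeffU (negPf gk).
Qed.

(* Nakayama's lemma for the finitely generated left R-module R[G]: if
   y = 1 - a j, then R[G] = R[G] y + J(R) S for S = G, and the elements of S
   can be eliminated one at a time, since 1 - J(R) consists of units. *)
Lemma jacobson_gr_const (j : R) :
  jacobson j -> jacobson (gr_const j : group_ring R gT).
Proof.
move=> Jj; apply: jacobson_left_inverse => a.
set y := 1 - a * gr_const j.
pose spanned (S : seq gT) := forall s : group_ring R gT,
  exists t (k : gT -> R), (forall h, jacobson (k h))
    /\ s = t * y + \sum_(h <- S) gr_mono (k h) h.
have span_all : spanned (enum gT).
  move=> s; exists s, (fun h => (s * a)@_h * j); split=> [h|].
    exact: jacobsonMl.
  rewrite [X in s = _ + X](_ : _ = s * a * gr_const j).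
    by rewrite /y; non_commutative_ring.
  rewrite [RHS]gr_mono_enum; apply: eq_bigr => h _.
  by rewrite mcoeff_monoMr invg1 mulg1.
clearbody y.
have eliminate h S : spanned (h :: S) -> spanned S.
  move=> spanS.
  have [t [k [Jk hE]]] := spanS (gr_mono 1 h).
  (* In the relation for [h] itself, moving the term at [h] to the left gives the unit factor
     [1 - k h], so [h] can be eliminated. *)
  have [v [_ vk]] : is_unit (1 - k h).
    by rewrite -[k h]mul1r; exact: Jk.
  have {}hE : gr_mono 1 h
      = gr_const v * t * y + \sum_(g <- S) gr_mono (v * k g) g.
    transitivity (gr_const v * (gr_mono 1 h - gr_mono (k h) h)).
      rewrite [gr_mono (k h) h]gr_mono_const -{2}[gr_mono 1 h]mul1r -mulrBl.
      by rewrite -(rmorph1 gr_const) -rmorphB mulrA -rmorphM vk rmorph1 mul1r.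
    have -> : gr_mono 1 h - gr_mono (k h) h
        = t * y + \sum_(g <- S) gr_mono (k g) g.
      by rewrite hE big_cons; non_commutative_ring.
    rewrite mulrDr mulrA; congr (_ + _).
    rewrite mulr_sumr; apply: eq_bigr => g _.
    by rewrite gr_monoM mul1g.
  move=> s; have [t' [k' [Jk' ->]]] := spanS s.
  exists (t' + gr_const (k' h) * (gr_const v * t)).
  exists (fun g => k' g + k' h * (v * k g)); split=> [g|].
    by apply: jacobsonD => //; do 2 apply: jacobsonMl.
  rewrite big_cons gr_mono_const hE mulrDr mulrDl -!addrA; congr (_ + _).
  rewrite !mulrA; congr (_ + _).
  under [in RHS]eq_bigr => g _ do rewrite /gr_mono monalgUD.
  rewrite big_split /= addrC; congr (_ + _).
  rewrite mulr_sumr; apply: eq_bigr => g _.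
  by rewrite gr_monoM mul1g.
have : spanned [::] by elim: (enum gT) span_all => // h S IHS /eliminate.
by move/(_ 1) => [t [k [_ ->]]]; exists t; rewrite big_nil addr0.
Qed.

End FiniteGroup.

(** Excluded middle turns subgroups given by a proposition into finite sequences. *)
Lemma classical_filter (T : eqType) (P : T -> Prop) (s : seq T) :
  exists t : seq T, forall x, x \in t <-> x \in s /\ P x.
Proof.
elim: s => [|y s [t tP]]; first by exists [::] => x; split=> // -[].
have [Py | nPy] := classic (P y).
  exists (y :: t) => x; rewrite !inE; split.
    by case/predU1P=> [->|/tP[xs Px]]; [rewrite eqxx | rewrite xs orbT].
  case=> /predU1P[->|xs Px]; rewrite ?eqxx //.
  by apply/orP; right; apply/tP.
exists t => x; rewrite inE tP; split=> -[xs Px]; split=> //.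
  by rewrite xs orbT.
by case/predU1P: xs => // xy; rewrite xy in Px.
Qed.

Section FiniteTwoGroup.
Context {R : nzRingType} {gT : finGroupType}.
Implicit Types (x y t : group_ring R gT) (g h : gT).

Hypothesis two_gT : (2.-group [set: gT])%g.
Hypothesis J2 : jacobson (1 - - 1 : R).

(* The elements [g] with [1 - g] in the radical form a normal subgroup [T]. If
   [z] is a central involution modulo [T], then [(1 - z) b] equals [b (1 - z)]
   modulo the radical, and [(1 - z)^2] equals [2 (1 - z)], so every
   [b (1 - z)] has its square in the radical: [z] belongs to [T] as well. *)
Lemma jacobson_two_group g : jacobson (1 - gr_mono (1 : R) g).
Proof.
pose m g := gr_mono (1 : R) g.
have mM a b : m (a * b)%g = m a * m b by exact: gr_mono1M.
have m1 : m 1%g = 1 by [].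
have [s sP] := classical_filter (fun g => eqJ 1 (m g)) (enum gT).
pose T := [set g in s].
have TP h : h \in T <-> eqJ 1 (m h).
  by rewrite inE sP mem_enum; split=> [[]|].
have gT_T : group_set T.
  apply/group_setP; split=> [|a b /TP aT /TP bT]; apply/TP.
    by rewrite m1; reflexivity.
  by rewrite mM -aT -bT mulr1; reflexivity.
pose K := Group gT_T.
have nK : (K <| [set: gT])%g.
  apply/andP; split; first exact: subsetT.
  apply/subsetP=> a _; rewrite inE; apply/subsetP=> _ /imsetP[b /TP bT ->].
  apply/TP; rewrite conjgE !mM -bT mul1r -mM mulVg m1; reflexivity.
suffices KT : K :=: [set: gT]%g.
  by apply/TP; rewrite -[T]/(gval K) KT inE.
apply/eqP/negPn/negP => KnT.
(* The quotient by [K] is a nontrivial 2-group, so its centre is nontrivial and contains an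
   involution [zb] by Cauchy; [z] is a lift of it. *)
have pQ : (2.-group ([set: gT] / K))%g by exact: quotient_pgroup.
have ntZ : ('Z([set: gT] / K) != 1)%g.
  rewrite (center_nil_eq1 (pgroup_nil pQ)) quotient_neq1 //.
  by rewrite properEneq KnT subsetT.
have [_ dvdZ _] := pgroup_pdiv (pgroupS (center_sub _) pQ) ntZ.
have [zb Zzb ozb] := Cauchy (isT : prime 2) dvdZ.
have [Qzb cZ] := setIP Zzb.
have [z Nz _ zbE] := morphimP Qzb.
have NT h : h \in ('N(K))%g by apply: (subsetP (normal_norm nK)); rewrite inE.
have zz : eqJ 1 (m z * m z).
  rewrite -mM; apply/TP; apply: (@coset_idr _ K) => //.
  by rewrite morphM // -zbE -expg2 -ozb expg_order.
have zh h : eqJ (m z * m h) (m h * m z).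
  have : (z * h * (h * z)^-1)%g \in T.
    apply: (@coset_idr _ K) => //; rewrite morphM ?morphV //= !morphM // -zbE.
    rewrite (centP cZ (coset K h)) ?mulgV //.
    by apply: mem_quotient; rewrite inE.
  move/TP => cJ; rewrite -!mM -[(z * h)%g](mulgVK (h * z)%g).
  rewrite (mM _ (h * z)%g) -cJ mul1r.
  by reflexivity.
have zb' b : eqJ (m z * b) (b * m z).
  rewrite /eqJ {1 2}[b]gr_monoE mulr_sumr mulr_suml -sumrB.
  apply: jacobson_sum => h; rewrite gr_mono_const mulrA -gr_const_comm.
  rewrite -!mulrA -mulrBr; apply: jacobsonMl; exact: zh.
have JZ : jacobson (1 - m z).
  move=> b; set x := b * (1 - m z).
  have xx : eqJ (x * x) 0.
    have -> : x * x = b * (b * (1 - m z) - (m z * b - b * m z)) * (1 - m z).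
      by rewrite /x; non_commutative_ring.
    rewrite zb' subrr subr0.
    have -> : b * (b * (1 - m z)) * (1 - m z)
      = b * b * ((1 - - 1) * (1 - m z) - (1 - m z * m z)).
      by non_commutative_ring.
    rewrite -zz subrr subr0 -eqJ0; apply: jacobsonMl; apply: jacobsonMr.
    have := jacobson_gr_const (gT := gT) J2.
    by rewrite rmorphB rmorphN rmorph1.
  have Uxx : is_unit (1 - x * x).
    by apply: (eqJ_is_unit is_unit1); rewrite xx subr0; reflexivity.
  apply: (@is_unit_factor _ _ (1 + x) (1 + x)).
    by have -> : (1 - x) * (1 + x) = 1 - x * x by non_commutative_ring.
  by have -> : (1 + x) * (1 - x) = 1 - x * x by non_commutative_ring.
have zT : z \in T by apply/TP.
have zb1 : zb = 1%g by rewrite zbE; exact: (@coset_id _ K).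
by rewrite zb1 order1 in ozb.
Qed.

(** Modulo the radical every group element is 1, so [x] is congruent to its augmentation, a constant
    congruent to 1. *)
Lemma finite_two_group_unit x : jacobson (1 - gr_aug x) -> is_unit x.
Proof.
move=> Jx; apply: (eqJ_is_unit is_unit1).
transitivity (gr_const (gr_aug x) : group_ring R gT).
  have := jacobson_gr_const (gT := gT) Jx.
  by rewrite rmorphB rmorph1.
rewrite /gr_aug mmapE rmorph_sum /= [X in eqJ _ X]gr_monoE /eqJ -sumrB.
apply: jacobson_sum => g; rewrite mulr1 [gr_mono _ g]gr_mono_const.
rewrite -{1}[gr_const _]mulr1 -mulrBr; apply: jacobsonMl.
exact: jacobson_two_group.
Qed.

End FiniteTwoGroup.

(** * Finite subgroups and local finiteness *)

Definition subgroup_closed (G : groupType) (s : seq G) : Prop :=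
  [/\ 1%g \in s, {in s &, forall g h, (g * h)%g \in s}
    & {in s, forall g, g^-1%g \in s}].

(** The closure proof [cl] is a parameter of the type so that the group structure on [s] can be
    inferred from it. *)
Definition finsub (G : groupType) (s : seq G) (cl : subgroup_closed s) : Type :=
  seq_sub s.

Section FiniteSubgroup.
Context (G : groupType) (s : seq G) (cl : subgroup_closed s).

HB.instance Definition _ := Finite.on (finsub cl).

Definition finsub_val (g : finsub cl) : G := ssval g.

Definition finsub_one : finsub cl :=
  SeqSub (let: And3 s1 _ _ := cl in s1).
Definition finsub_mul (g h : finsub cl) : finsub cl :=
  SeqSub (let: And3 _ sM _ := cl in sM _ _ (ssvalP g) (ssvalP h)).
Definition finsub_inv (g : finsub cl) : finsub cl :=
  SeqSub (let: And3 _ _ sV := cl in sV _ (ssvalP g)).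

Lemma finsub_val_inj : injective finsub_val.
Proof. exact: val_inj. Qed.

Fact finsub_mulA : associative finsub_mul.
Proof. by move=> g h k; apply: finsub_val_inj; exact: mulgA. Qed.
Fact finsub_mul1 : left_id finsub_one finsub_mul.
Proof. by move=> g; apply: finsub_val_inj; exact: mul1g. Qed.
Fact finsub_mulV : left_inverse finsub_one finsub_inv finsub_mul.
Proof. by move=> g; apply: finsub_val_inj; exact: mulVg. Qed.

HB.instance Definition _ := Finite_isGroup.Build (finsub cl)
  finsub_mulA finsub_mul1 finsub_mulV.

Lemma finsub_valX g n : finsub_val (g ^+ n)%g = (finsub_val g ^+ n)%g.
Proof. by elim: n => // n IHn; rewrite !expgS -IHn. Qed.

Lemma finsub_two_group : two_group G -> (2.-group [set: finsub cl])%g.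
Proof.
move=> twoG; apply/pgroupP => p p_pr /(Cauchy p_pr)[g _ og].
have [n [_ gn _]] := twoG (finsub_val g).
have: (g ^+ (2 ^ n) == 1)%g.
  by apply/eqP; apply: finsub_val_inj; rewrite finsub_valX.
rewrite -order_dvdn og Euclid_dvdX // => /andP[].
by rewrite dvdn_prime2.
Qed.

End FiniteSubgroup.

Definition gr_map {R : nzRingType} {H G : groupType} (v : H -> G) :
    group_ring R H -> group_ring R G :=
  mmap gr_const (fun h => gr_mono 1 (v h)).

HB.instance Definition _ (R : nzRingType) (H G : groupType) (v : H -> G) :=
  GRing.Additive.copy (@gr_map R H G v)
    (mmap gr_const (fun h => gr_mono 1 (v h))).

Lemma gr_map_mono (R : nzRingType) (H G : groupType) (v : H -> G) (a : R) h :
  gr_map v (gr_mono a h) = gr_mono a (v h).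
Proof. by rewrite [LHS](mmapU (f := gr_const)) [RHS]gr_mono_const. Qed.

Lemma gr_map_is_unit (R : nzRingType) (H G : groupType) (v : H -> G)
    (x : group_ring R H) :
  {morph v : g h / (g * h)%g >-> (g * h)%g} ->
  is_unit x -> is_unit (gr_map v x).
Proof.
move=> vM [y [xy yx]].
have v1 : v 1%g = 1%g by apply: (mulgI (v 1%g)); rewrite -vM !mulg1.
have mapM (x1 x2 : group_ring R H) :
    gr_map v (x1 * x2) = gr_map v x1 * gr_map v x2.
  apply: mmapM => [g h | a g]; first by rewrite vM gr_mono1M.
  exact: gr_const_comm.
have map1 : gr_map v 1 = 1 :> group_ring R G.
  by rewrite gr_map_mono v1.
by exists (gr_map v y); split; rewrite -mapM ?xy ?yx.
Qed.

(** The support of [x] generates a finite 2-group, and [x] comes from an element of its group ring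
    with the same augmentation. *)
Lemma locally_finite_two_group_unit (R : nzRingType) (G : groupType)
    (x : group_ring R G) :
  jacobson (1 - - 1 : R) -> locally_finite G -> two_group G ->
  jacobson (1 - gr_aug x) -> is_unit x.
Proof.
move=> J2 lfG twoG Jx.
have [t genP] := lfG (enum_fset (msupp x)).
have [s sP] := classical_filter (in_generated (enum_fset (msupp x))) t.
have {genP}sP g : g \in s <-> in_generated (enum_fset (msupp x)) g.
  by rewrite sP; split=> [[]|gen] //; split=> //; exact: genP.
have cl : subgroup_closed s.
  split=> [|g h /sP sg /sP sh|g /sP sg]; apply/sP.
  - exact: in_generated_one.
  - exact: in_generated_mul.
  - exact: in_generated_inv.
pose y : group_ring R (finsub cl) :=
  \sum_(h : finsub cl) gr_mono x@_(finsub_val h) h.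
have yx : gr_map (@finsub_val _ _ cl) y = x.
  rewrite /y raddf_sum; apply/malgP => k; rewrite raddf_sum /=.
  under eq_bigr => h _ do rewrite gr_map_mono /gr_mono mcoeffU.
  have [ks | kns] := boolP (k \in s).
    rewrite (bigD1 (SeqSub ks : finsub cl)) //= eqxx big1 ?addr0 // => h hk.
    case: eqP => // kE; case/eqP: hk; apply: finsub_val_inj; exact: kE.
  rewrite big1 => [|h _].
    apply/esym/mcoeff_outdom; apply: contra kns => kx; apply/sP.
    exact: in_generated_base.
  by case: eqP => // kE; case/negP: kns; rewrite -kE; exact: (ssvalP h).
rewrite -yx; apply: gr_map_is_unit => //.
apply: finite_two_group_unit => //; first exact: finsub_two_group.
rewrite (_ : gr_aug y = gr_aug x) //.
rewrite -yx /y raddf_sum [gr_map _ _]raddf_sum [RHS]raddf_sum.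
apply: eq_bigr => h _ /=; by rewrite gr_map_mono !gr_aug_mono.
Qed.

Lemma gr_aug_jacobson (R : nzRingType) (G : groupType) (x : group_ring R G) :
  jacobson x -> jacobson (gr_aug x).
Proof.
move=> Jx a.
have -> : 1 - a * gr_aug x = gr_aug (1 - gr_const a * x).
  by rewrite rmorphB rmorph1 rmorphM /= gr_aug_mono.
by apply: rmorph_is_unit; exact: Jx.
Qed.

(** A constant idempotent [e] suffices: [1 - y (x - e)] has augmentation in 1 + J(R) for every
    [y]. *)
Lemma jclean_group_ring (R : nzRingType) (G : groupType) :
  jclean R -> locally_finite G -> two_group G -> jclean (group_ring R G).
Proof.
move=> jcR lfG twoG x; have [e ee Je] := jcR (gr_aug x).
have J2 : jacobson (1 - - 1 : R).
  by apply: (jclean_unit jcR); apply: is_unitN; exact: is_unit1.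
exists (gr_const e); first by rewrite /is_idempotent -rmorphM ee.
move=> y; apply: locally_finite_two_group_unit => //.
rewrite rmorphB rmorph1 subKr rmorphM rmorphB /=.
rewrite [gr_aug (gr_const e)]gr_aug_mono.
exact: jacobsonMl.
Qed.

Lemma jclean_coefficients (R : nzRingType) (G : groupType) :
  jclean (group_ring R G) -> jclean R.
Proof.
move=> jcRG a; have [e ee Je] := jcRG (gr_const a).
exists (gr_aug e); first by rewrite /is_idempotent -rmorphM ee.
have := gr_aug_jacobson Je.
by rewrite rmorphB /= gr_aug_mono.
Qed.

(** * Orders of group elements *)

Section TwoGroup.
Context {R : nzRingType} {G : groupType}.
Hypothesis jcRG : jclean (group_ring R G).
Implicit Types g h : G.

(** Modulo the radical [g] is 1 and 2 is 0, so two consecutive powers of [g] cancel and only the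
    first term 1 remains. *)
Lemma jclean_odd_sum_unit g k :
  is_unit (\sum_(i < k.*2.+1) gr_mono (1 : R) g ^+ i).
Proof.
set m := gr_mono 1 g.
have m1 : eqJ 1 m.
  apply: (jclean_unit jcRG); exists (gr_mono 1 g^-1%g).
  by split; rewrite gr_monoM mulr1 ?mulgV ?mulVg.
have J2 : eqJ (1 + 1) (0 : group_ring R G).
  rewrite -eqJ0 -{2}[1]opprK; apply: (jclean_unit jcRG).
  by apply: is_unitN; exact: is_unit1.
apply: (eqJ_is_unit is_unit1); elim: k => [|k IHk].
  by rewrite big_ord1 expr0; reflexivity.
rewrite doubleS 2!big_ord_recr /= -IHk (exprSr m k.*2.+1) -addrA.
rewrite -[X in X + _ * m]mulr1 -mulrDr; move: (m ^+ _) => p.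
by rewrite -m1 J2 mulr0 addr0; reflexivity.
Qed.

(** Write the order as [q 2^k] with [q] odd and put [h = g^(2^k)]. The unit
    [1 + h + ... + h^(q - 1)] annihilates [h - 1], so [h = 1]. *)
Lemma jclean_finite_order g n : (0 < n)%N -> (g ^+ n)%g = 1%g ->
  exists k, has_order g (2 ^ k).
Proof.
move=> n0 gn; have exn : exists n, (0 < n)%N && ((g ^+ n)%g == 1%g).
  by exists n; rewrite n0 gn eqxx.
case: (ex_minnP exn) => {gn} m /andP[m0 /eqP gm] mmin.
have [q q2 mE] := pfactor_coprime (isT : prime 2) m0.
exists (logn 2 m); split; rewrite ?expn_gt0 //; last first.
  move=> k k0 gk; apply: leq_trans (mmin k _); last by rewrite k0 gk eqxx.
  by rewrite {2}mE leq_pmull //; case: q q2 {mE}.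
apply: (@gr_mono1_inj R); set h := (g ^+ _)%g.
have hq : (h ^+ q)%g = 1%g by rewrite /h -expgnA mulnC -mE.
have [v [sv _]] := jclean_odd_sum_unit h q./2.
have qE : q./2.*2.+1 = q.
  by rewrite -[RHS]odd_double_half -coprime2n q2.
rewrite qE in sv; apply/subr0_eq; rewrite gr_mono11.
transitivity ((gr_mono 1 h - 1) * (\sum_(i < q) gr_mono (1 : R) h ^+ i * v)).
  by rewrite -mulr_suml sv mulr1.
by rewrite -mulr_suml mulrA -subrX1 -gr_mono1X hq subrr mul0r.
Qed.

(** Pigeonhole. The index [n.+1] leaves out the exponent 0, which is not on the ray g^-3, g^-6,
    ... *)
Lemma injective_escapes (f : nat -> G) (s : seq G) :
  injective f -> exists n, f n.+1 \notin s.
Proof.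
move=> f_inj; apply: NNPP => nesc.
have sub : {subset [seq f i.+1 | i <- iota 0 (size s).+1] <= s}.
  move=> _ /mapP[i _ ->]; apply/negPn/negP => ns; apply: nesc; by exists i.
have := uniq_leq_size _ sub; rewrite size_map size_iota ltnn => contra.
suff : false by [].
by apply: contra; rewrite map_inj_uniq ?iota_uniq // => i j /f_inj [].
Qed.

(* If [g] has infinite order and [(1 + g + g^2) y = 1], then
   [g^3 y - y = g - 1], so that the coefficients of [y] are constant on
   [g^0, g^3, g^6, ...] and on [g^-3, g^-6, ...]: they vanish there, whereas the
   coefficients at [1] and [g^-3] differ by [1]. *)
Lemma jclean_torsion g : exists2 n, (0 < n)%N & (g ^+ n)%g = 1%g.
Proof.
apply: NNPP => ninf.
have gX n : (0 < n)%N -> (g ^+ n == 1)%g = false.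
  by move=> n0; apply/eqP => gn; apply: ninf; exists n.
(* The argument 1 gives the three-term sum [1 + g + g^2]. *)
have [y [Ny _]] := jclean_odd_sum_unit g 1.
have yE k : y@_((g ^+ 3)^-1 * k)%g - y@_k = (g == k)%:R - (1%g == k)%:R.
  have : (gr_mono 1 (g ^+ 3)%g - 1) * y = gr_mono 1 g - 1.
    by rewrite gr_mono1X (subrX1 _ 3) -mulrA Ny mulr1.
  move/(congr1 (mcoeff k)); rewrite mulrBl mul1r !mcoeffB mcoeff_monoMl mul1r.
  rewrite [gr_mono 1 g]/gr_mono -[1 in X in _ = _ - X]gr_mono11.
  by rewrite /gr_mono !mcoeffU.
have expI i j : (g ^+ i = g ^+ j)%g -> i = j.
  suffices lt a b : (a < b)%N -> (g ^+ a = g ^+ b)%g -> False.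
    by case: (ltngtP i j) => // /lt + E => /(_ _)/[dup]; rewrite E.
  move=> ab E; suff: (g ^+ (b - a) == 1)%g by rewrite gX ?subn_gt0.
  by apply/eqP/(mulgI (g ^+ a)%g); rewrite -expgnDr subnKC ?mulg1 // ltnW.
have exp3I : injective (fun k => g ^+ (3 * k))%g.
  by move=> i j /expI /eqP; rewrite eqn_pmul2l // => /eqP.
have up : y@_1%g = 0.
  have const k : y@_(g ^+ (3 * k))%g = y@_1%g.
    elim: k => [|k IHk]; first by rewrite muln0.
    have := yE (g ^+ (3 * k.+1))%g.
    have -> : (g == g ^+ (3 * k.+1))%g = false.
      by apply/eqP => /(expI 1%N); lia.
    have -> : (1 == g ^+ (3 * k.+1))%g = false by rewrite eq_sym gX.
    rewrite subrr mulnS expgnDr mulKg IHk.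
    by move/eqP; rewrite subr_eq0 => /eqP.
  have [k nk] := injective_escapes (msupp y) exp3I.
  by rewrite -(const k.+1) mcoeff_outdom.
have down : y@_(g ^+ 3)^-1%g = 0.
  have const k : y@_(g ^+ (3 * k.+1))^-1%g = y@_(g ^+ 3)^-1%g.
    elim: k => [|k IHk]; first by rewrite muln1.
    have := yE (g ^+ (3 * k.+1))^-1%g.
    have -> : (g == (g ^+ (3 * k.+1))^-1)%g = false.
      apply/eqP => /(congr1 (fun h => g ^+ (3 * k.+1) * h))%g.
      by rewrite mulgV -expgSr => /eqP; rewrite gX.
    have -> : (1 == (g ^+ (3 * k.+1))^-1)%g = false.
      by rewrite eq_sym invg_eq1 gX.
    rewrite subrr -invgM -expgnDr addnC -mulnS IHk.
    by move/eqP; rewrite subr_eq0 => /eqP.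
  have [k nk] := injective_escapes (msupp y) (inj_comp invg_inj exp3I).
  by rewrite -(const k) mcoeff_outdom.
(* At the identity, [yE] now reads [0 - 0 = 0 - 1]. *)
have := yE 1%g; rewrite mulg1 down up.
have -> : (g == 1%g) = false by exact: (gX 1%N).
by rewrite eqxx !sub0r oppr0 => /eqP; rewrite eq_sym oppr_eq0 oner_eq0.
Qed.

Lemma jclean_two_group : two_group G.
Proof.
by move=> g; have [n n0 /jclean_finite_order] := jclean_torsion g; exact.
Qed.

End TwoGroup.

Theorem theorem2p19 (R : nzRingType) (G : groupType) :
  (UnitUC (group_ring R G) -> UnitUC R /\ two_group G) /\
  (UnitUC R -> locally_finite G -> two_group G -> UnitUC (group_ring R G)).
Proof.
split=> [/UnitUC_jclean jcRG | /UnitUC_jclean jcR lfG twoG].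
  split; last exact: jclean_two_group jcRG.
  by apply: jclean_UnitUC; exact: jclean_coefficients jcRG.
by apply: jclean_UnitUC; exact: jclean_group_ring.
Qed.
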